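(* Let $g:U\times X\to X$ be a driven system. If $g$ has the unique solution property (USP), then $g$ has the global-input related stability (GIRST). Conversely, if $g$ has the GIRST and has precisely one solution for at least one input $\bar u\in\overline{U}$, then $g$ has the USP. In particular, if $g$ has precisely one solution for some input $\bar u$, then the GIRST and the USP are equivalent.
   Context: A driven system consists of a metric space $(U,d_U)$ (not assumed compact), a compact metric space $(X,d)$ and a continuous map $g:U\times X\to X$. Write $g_u(x):=g(u,x)$. Let $\overline{U}:=\prod_{i\in\mathbb{Z}}U$ and $\overleftarrow{U}:=\prod_{i=-\infty}^{-1}U$, with product topologies; elements of $\overleftarrow{U}$ are written $\overleftarrow{u}=(\ldots,u_{-2},u_{-1})$. A solution for input $\bar u=\{u_n\}\in\overline{U}$ is a sequence $\{x_n\}_{n\in\mathbb{Z}}$ in $X$ with $x_{n+1}=g(u_n,x_n)$ for all $n\in\mathbb{Z}$. The system $g$ has the unique solution property (USP) if for each $\bar u\in\overline{U}$ there is exactly one solution. $\mathsf{H}_X$ is the space of nonempty closed subsets of $X$ with the Hausdorff metric. The encoding map is $\mathcal{E}:\overleftarrow{U}\to\mathsf{H}_X$, $\mathcal{E}(\overleftarrow{u}):=\bigcap_{n\ge1}g_{u_{-1}}\circ\cdots\circ g_{u_{-n}}(X)$. The system $g$ has the global-input related stability (GIRST) if $\mathcal{E}:\overleftarrow{U}\to\mathsf{H}_X$ is continuous. *)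

(* Defs.v *)
From HB Require Import structures.
From mathcomp Require Import all_boot all_order all_algebra.
From mathcomp Require Import all_classical all_reals all_analysis.

Set Implicit Arguments.
Unset Strict Implicit.
Unset Printing Implicit Defensive.

Import Order.TTheory GRing.Theory Num.Theory.
Import numFieldNormedType.Exports.

Local Open Scope classical_set_scope.
Local Open Scope ring_scope.

Section hausdorff_distance.
Context {R : realType} {X : metricType R}.

Definition dist_to_set (x : X) (B : set X) : R :=
  inf [set mdist x b | b in B].

(* The real suprema and infima are the intended ones on nonempty subsets of a
   bounded space; [sup] and [inf] take the value 0 elsewhere. *)
Definition hausdorff_dist (A B : set X) : R :=
  Num.max (sup [set dist_to_set a B | a in A])
          (sup [set dist_to_set b A | b in B]).

Lemma hausdorff_distC A B : hausdorff_dist A B = hausdorff_dist B A.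
Proof. exact: maxC. Qed.

Lemma dist_to_set_le x y (B : set X) : B y -> dist_to_set x B <= mdist x y.
Proof.
move=> By; apply: ge_inf; last by exists y.
by exists 0 => _ [b _ <-]; exact: mdist_ge0.
Qed.

Lemma le_dist_to_set x (B : set X) r : B !=set0 ->
  (forall b, B b -> r <= mdist x b) -> r <= dist_to_set x B.
Proof.
by move=> [b Bb] h; apply: lb_le_inf => [|_ [c Bc <-]]; [exists (mdist x b), b|exact: h].
Qed.

Lemma dist_to_set_ge0 x (B : set X) : B !=set0 -> 0 <= dist_to_set x B.
Proof. by move=> B0; apply: le_dist_to_set => // b _; exact: mdist_ge0. Qed.

Lemma dist_to_set_eq0 x (B : set X) : B !=set0 -> closed B ->
  dist_to_set x B <= 0 -> B x.
Proof.
move=> [b Bb] cB h; apply: cB => V /nbhs_ballP[e /= e0 xeV].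
have : dist_to_set x B < e by exact: le_lt_trans h e0.
case/inf_lt => [|_ [c Bc <-] xc].
  by exists (mdist x b), b.
by exists c; split => //; apply: xeV; rewrite ballEmdist.
Qed.

Hypothesis cX : compact [set: X].

Lemma compact_mdist_bounded (x : X) : exists M : R, forall y, mdist x y <= M.
Proof.
have [n _ /(_ n (leqnn n)) h] : \forall n \near \oo,
    [set: X] `<=` (fun y => mdist x y <= n%:R); last first.
  by exists n%:R => y; exact: h.
have /compact_near_coveringP := cX; apply.
  move=> y _; exists (ball y 1, [set n | mdist x y + 1 <= n%:R]) => /=.
    split; first exact: nbhsx_ballx.
    exact: nbhs_infty_ger.
  move=> [z n] [/=]; rewrite ballEmdist/= => yz xyn.
  apply: le_trans xyn; apply: le_trans (metric_triangle _ y _) _.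
  by rewrite lerD2l ltW.
Qed.

Lemma dist_to_set_has_sup (A B : set X) : A !=set0 -> B !=set0 ->
  has_sup [set dist_to_set a B | a in A].
Proof.
move=> [a Aa] [b Bb]; split; first by exists (dist_to_set a B), a.
have [M hM] := compact_mdist_bounded b; exists M => _ [c Ac <-].
by apply: le_trans (dist_to_set_le _ Bb) _; rewrite metric_sym.
Qed.

Lemma dist_to_set_le_hausdorff (A B : set X) a : B !=set0 -> A a ->
  dist_to_set a B <= hausdorff_dist A B.
Proof.
move=> B0 Aa; rewrite /hausdorff_dist le_max; apply/orP; left.
apply: ub_le_sup; last by exists a.
by have [] : has_sup [set dist_to_set a B | a in A];
  [apply: dist_to_set_has_sup => //; exists a|].
Qed.

Lemma hausdorff_dist_le (A B : set X) r : A !=set0 -> B !=set0 ->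
  (forall a, A a -> dist_to_set a B <= r) ->
  (forall b, B b -> dist_to_set b A <= r) -> hausdorff_dist A B <= r.
Proof.
move=> [a Aa] [b Bb] hA hB; rewrite /hausdorff_dist ge_max.
apply/andP; split; apply: ge_sup => [|_ [c ? <-]].
- by exists (dist_to_set a B), a.
- exact: hA.
- by exists (dist_to_set b A), b.
- exact: hB.
Qed.

Lemma hausdorff_distxx (A : set X) : A !=set0 -> hausdorff_dist A A = 0.
Proof.
move=> A0; have h a : A a -> dist_to_set a A <= 0.
  by move=> Aa; rewrite -(mdistxx a); exact: dist_to_set_le.
apply/eqP; rewrite eq_le hausdorff_dist_le//=.
case: (A0) => a Aa; apply: le_trans (dist_to_set_le_hausdorff A0 Aa).
exact: dist_to_set_ge0.
Qed.

Lemma hausdorff_dist_eq0 (A B : set X) : A !=set0 -> B !=set0 ->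
  closed A -> closed B -> hausdorff_dist A B = 0 -> A = B.
Proof.
move=> A0 B0 cA cB h; apply/seteqP; split => x hx; apply: dist_to_set_eq0 => //.
  by rewrite -h; exact: dist_to_set_le_hausdorff.
by rewrite -h hausdorff_distC; exact: dist_to_set_le_hausdorff.
Qed.

Let hausdorff_dist_tri1 (A B C : set X) a : B !=set0 -> C !=set0 -> A a ->
  dist_to_set a C <= hausdorff_dist A B + hausdorff_dist B C.
Proof.
move=> B0 C0 Aa; rewrite -lerBlDr.
apply: le_trans (dist_to_set_le_hausdorff B0 Aa).
apply: le_dist_to_set => // b Bb; rewrite lerBlDr.
apply: (@le_trans _ _ (mdist a b + dist_to_set b C)); last first.
  by rewrite lerD2l; exact: dist_to_set_le_hausdorff.
rewrite -lerBlDl; apply: le_dist_to_set => // c Cc.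
rewrite lerBlDl; apply: le_trans (metric_triangle a b c).
exact: dist_to_set_le.
Qed.

Lemma hausdorff_dist_triangle (B A C : set X) :
  A !=set0 -> B !=set0 -> C !=set0 ->
  hausdorff_dist A C <= hausdorff_dist A B + hausdorff_dist B C.
Proof.
move=> A0 B0 C0; apply: hausdorff_dist_le => // [a|c] h.
  exact: hausdorff_dist_tri1.
by rewrite addrC (hausdorff_distC A) (hausdorff_distC B); exact: hausdorff_dist_tri1.
Qed.

End hausdorff_distance.

(* The compactness proof is a parameter because the Hausdorff distance is a
   (finite) metric only on a bounded space. *)
Definition hyperspace (R : realType) (X : metricType R)
    (cX : compact [set: X]) : Type :=
  {A : set X | A !=set0 /\ closed A}.

Section hyperspace_metric.
Context {R : realType} {X : metricType R} (cX : compact [set: X]).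

HB.instance Definition _ := gen_eqMixin (hyperspace cX).
HB.instance Definition _ := gen_choiceMixin (hyperspace cX).

Definition hyperspace_dist (A B : hyperspace cX) : R :=
  hausdorff_dist (sval A) (sval B).

Let distxx A : hyperspace_dist A A = 0.
Proof. by case: A => A [A0 cA]; exact: hausdorff_distxx. Qed.

Let dist_eq0 A B : hyperspace_dist A B = 0 -> A = B.
Proof.
case: A B => [A [A0 cA]] [B [B0 cB]] h; apply: eq_exist => /=.
exact: (hausdorff_dist_eq0 cX).
Qed.

Let distC A B : hyperspace_dist A B = hyperspace_dist B A.
Proof. exact: hausdorff_distC. Qed.

Let dist_triangle B A C :
  hyperspace_dist A C <= hyperspace_dist A B + hyperspace_dist B C.
Proof.
by case: A B C => [A [? ?]] [B [? ?]] [C [? ?]]; exact: hausdorff_dist_triangle.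
Qed.

HB.instance Definition _ := isMetric.Build R (hyperspace cX)
  distxx dist_eq0 distC dist_triangle.

End hyperspace_metric.

(* [X] must be nonempty for the encoding map to take its values in the space
   of nonempty closed subsets of [X]. *)
Record driven_system (R : realType) (U X : metricType R) := DrivenSystem {
  driving_map :> U * X -> X ;
  state_compact : compact [set: X] ;
  state_nonempty : [set: X] !=set0 ;
  driving_continuous : continuous driving_map }.

Section driven_system.
Context {R : realType} {U X : metricType R} (g : driven_system U X).

Definition solution (u : int -> U) (x : int -> X) : Prop :=
  forall n : int, x (n + 1) = g (u n, x n).

Definition unique_solution (u : int -> U) : Prop := exists! x, solution u x.

Definition USP : Prop := forall u : int -> U, unique_solution u.

(* A left-infinite input (..., u_{-2}, u_{-1}) is the function k |-> u_{-(k+1)}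
   on nat, so [past_map u n] is g_{u_{-1}} \o ... \o g_{u_{-n}}. *)
Fixpoint past_map (u : nat -> U) (n : nat) : X -> X :=
  if n is m.+1 then past_map u m \o (fun x => g (u m, x)) else id.

Definition encoding_set (u : nat -> U) : set X :=
  \bigcap_(n in [set n | (1 <= n)%N]) (past_map u n @` [set: X]).

Lemma past_map_continuous u n : continuous (past_map u n).
Proof.
elim: n => [|n IHn] x /=; first exact: cvg_id.
apply: (@continuous_comp _ _ _ (fun x => g (u n, x))); last exact: IHn.
apply: (@continuous_comp _ _ _ (fun x => (u n, x)) g); last exact: driving_continuous.
by apply: cvg_pair; [exact: cvg_cst|exact: cvg_id].
Qed.

Lemma past_map_closed u n : closed (past_map u n @` [set: X]).
Proof.
apply: (@compact_closed X); first exact: (@metric_hausdorff R X).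
apply: continuous_compact; last exact: (state_compact g).
exact/continuous_subspaceT/past_map_continuous.
Qed.

Lemma past_map_subset u n k :
  past_map u (n + k) @` [set: X] `<=` past_map u n @` [set: X].
Proof.
elim: k => [|k IHk]; first by rewrite addn0.
apply: subset_trans IHk => _ [x _ <-].
by rewrite addnS /=; exists (g (u (n + k)%N, x)).
Qed.

Lemma encoding_set_closed u : closed (encoding_set u).
Proof. by apply: closed_bigI => n _; exact: past_map_closed. Qed.

Lemma encoding_set_nonempty u : encoding_set u !=set0.
Proof.
have [x _] := state_nonempty g.
have [p [_ clp]] : [set: X] `&` cluster ((past_map u)^~ x @ \oo) !=set0.
  by apply: (state_compact g) => //; exact: filterT.
exists p => n _; apply: past_map_closed => V Vp.
have [|q [[z _ <-] Vq]] := clp (past_map u n @` [set: X]) V _ Vp.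
  by exists n => // m /= /subnKC <-; apply: (@past_map_subset u n (m - n)%N); exists x.
by exists (past_map u n z); split => //; exists z.
Qed.

Definition encoding (u : {ptws nat -> U}) : hyperspace (state_compact g) :=
  exist _ (encoding_set u)
    (conj (encoding_set_nonempty u) (encoding_set_closed (u := u))).

Definition GIRST : Prop := continuous encoding.

End driven_system.

(* Main.v *)
Require Import Defs.
From mathcomp Require Import all_boot all_order all_algebra.
From mathcomp Require Import all_classical all_reals all_analysis.
From mathcomp Require Import zify.

Import Order.TTheory GRing.Theory Num.Theory.

(** Both properties are compared with a third one: every encoding set is a
singleton.

The bridge is [encoding_setP]: the points of the encoding set of a past input
are exactly the endpoints of its backward orbits. A backward orbit extends
forwards by iterating the map, so the points of the encoding set are the time-0
values of the solutions driven by any input with that past. Hence the USP says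
that no encoding set has two points ([USP_encodingP]), and a single input with a
unique solution already provides one past whose encoding set is a singleton
([unique_solution_encoding]).

If the encoding set of v is a singleton {p}, then some finite composition
g_{v_{-1}} o ... o g_{v_{-n}} already maps X into a given ball around p, and by
compactness of X this persists for inputs near v, which bounds the Hausdorff
distance. So the USP gives continuity ([encoding_continuous_at_set1]).

Conversely, suppose that the encoding is continuous and that it is a singleton
at one past p. It is then a singleton at every past that prolongs p by finitely
many entries, since a backward orbit of such a past is determined by its point
in the encoding set of p ([splice_set1]). These pasts
are dense ([splice_cvg]), and a Hausdorff limit of singletons is a singleton
([encoding_set1_limit]); so all encoding sets are singletons. *)

Local Open Scope classical_set_scope.
Local Open Scope ring_scope.

(** Each point of the space either lies in V or has a neighbourhood missed by
some K m, hence by all later ones; compactness makes the index uniform. *)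
Lemma decreasing_closed_sub_open (T : topologicalType) (K : nat -> set T)
    (V : set T) :
  compact [set: T] -> (forall n, closed (K n)) ->
  (forall m n, (m <= n)%N -> K n `<=` K m) ->
  open V -> \bigcap_n K n `<=` V -> exists n, K n `<=` V.
Proof.
move=> /compact_near_coveringP cT clK decK oV KV.
have [n _ /(_ n (leqnn n)) h] : \forall n \near \oo,
    [set: T] `<=` (fun x => K n x -> V x); last by exists n => x; exact: h.
apply: cT => x _; have [Vx|nVx] := pselect (V x).
  exists (V, [set: nat]) => /=; last by move=> [y n] [].
  by split; [exact: open_nbhs_nbhs|exact: filterT].
have [m nKm] : exists m, ~ K m x.
  apply: contrapT => /forallNP h; apply: nVx; apply: KV => m _.
  by apply: contrapT; exact: h.
exists (~` K m, [set n | (m <= n)%N]) => /=.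
  split; last by exists m.
  by apply: open_nbhs_nbhs; split; [exact: closed_openC (clK m)|exact: nKm].
by move=> [y n] /= [nKy mn] Ky; case: nKy; exact: (decK m n).
Qed.

Lemma hausdorff_dist_set1_le (R : realType) (X : metricType R) (p : X)
    (A B : set X) (e : R) :
  A !=set0 -> A `<=` [set p] -> B !=set0 -> B `<=` ball p e ->
  hausdorff_dist A B <= e.
Proof.
move=> [a Aa] Ap B0 Be; have ap := Ap _ Aa; rewrite ap in Aa.
have pB b : B b -> mdist p b <= e.
  by move=> /Be; rewrite ballEmdist => /ltW.
apply: hausdorff_dist_le => // [|c /Ap ->|b Bb]; first by exists p.
  have [b Bb] := B0; exact: le_trans (dist_to_set_le _ Bb) (pB b Bb).
by apply: le_trans (dist_to_set_le _ Aa) _; rewrite metric_sym; exact: pB.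
Qed.

(** * Encoding sets, backward orbits and solutions *)

Section encoding_orbits.
Context {R : realType} {U X : metricType R} (g : driven_system U X).

(** The point [y k] is the state at time [-k], in accordance with the indexing
of past inputs by [k |-> u_{-(k+1)}]. *)
Definition backward_orbit (u : nat -> U) (y : nat -> X) : Prop :=
  forall k, y k = g (u k, y k.+1).

Lemma past_map_recl (u : nat -> U) n x :
  past_map g u n.+1 x = g (u 0%N, past_map g (fun k => u k.+1) n x).
Proof. by elim: n x => [//|n IHn] x; rewrite [LHS]IHn. Qed.

Lemma backward_orbit_past_map {u y} n :
  backward_orbit u y -> y 0%N = past_map g u n (y n).
Proof. by move=> yu; elim: n => [//|n ->] /=; rewrite -yu. Qed.

Lemma backward_orbit_encoding {u y} :
  backward_orbit u y -> encoding_set g u (y 0%N).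
Proof.
by move=> yu n _; exists (y n) => //; rewrite -backward_orbit_past_map.
Qed.

Lemma past_map_decreasing (u : nat -> U) m n : (m <= n)%N ->
  past_map g u n @` [set: X] `<=` past_map g u m @` [set: X].
Proof. by move=> /subnKC <-; exact: past_map_subset. Qed.

(** For each n the compact image of [past_map g v n] meets the fibre of
[g_{u 0}] over x, because x lies in the image of [past_map g u n.+1]; by
compactness the intersection of these images meets the fibre too. *)
Lemma encoding_set_preimage {u x} : encoding_set g u x ->
  exists2 z, x = g (u 0%N, z) & encoding_set g (fun k => u k.+1) z.
Proof.
move=> ux; apply: contrapT => nz; set v := fun k => u k.+1.
have [||||n] := @decreasing_closed_sub_open X (fun n => past_map g v n @` setT)
    ((fun z => g (u 0%N, z)) @^-1` ~` [set x]) (state_compact g).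
- exact: past_map_closed.
- exact: past_map_decreasing.
- apply: open_comp => [z _|].
    apply: (@continuous_comp _ _ _ (fun z => (u 0%N, z)) g).
      by apply: cvg_pair; [exact: cvg_cst|exact: cvg_id].
    exact: driving_continuous.
  by apply: closed_openC; exact: accessible_closed_set1
    (hausdorff_accessible (@metric_hausdorff R X)) _.
- by move=> z vz /= zx; apply: nz; exists z => // n _; exact: vz.
have [t _ tx] := ux n.+1 isT.
move=> /(_ (past_map g v n t)); apply; first by exists t.
by rewrite -tx past_map_recl.
Qed.

(** Pulling a point back one step at a time by [encoding_set_preimage] builds a
backward orbit by dependent choice. *)
Lemma encoding_setP (u : nat -> U) x :
  encoding_set g u x <-> exists2 y, backward_orbit u y & y 0%N = x.
Proof.
split=> [ux|[y yu <-]]; last exact: backward_orbit_encoding.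
pose E k := encoding_set g (fun i => u (k + i)%N).
(* The pair (k, z) stands for a state z at time -k; f picks a preimage. *)
have /choice[f fP] (p : nat * X) : exists z, E p.1 p.2 ->
    p.2 = g (u p.1, z) /\ E p.1.+1 z.
  have [/encoding_set_preimage[z pz Ez]|nE] := pselect (E p.1 p.2).
    exists z => _; rewrite pz addn0; split=> //; congr encoding_set: Ez.
    by apply/funext => i; rewrite addnS.
  by exists p.2 => /nE.
pose y := fix y k := if k is k'.+1 then f (k', y k') else x.
have Ey k : E k (y k) by elim: k => [//|k /(fP (k, _))[]].
by exists y => // k; have [] := fP (k, y k) (Ey k).
Qed.

(** The left-infinite input seen at time [n], most recent entry first. *)
Definition past (u : int -> U) (n : int) (k : nat) : U := u (n - k.+1%:Z).

Lemma solution_encoding u x n :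
  solution g u x -> encoding_set g (past u n) (x n).
Proof.
move=> xu; apply/encoding_setP; exists (fun k => x (n - k%:Z)); last first.
  by rewrite subr0.
by move=> k; rewrite /past -xu; congr x; lia.
Qed.

(** A backward orbit serves for the negative times, and iterating the map from
its endpoint for the nonnegative ones. *)
Lemma encoding_solution u x : encoding_set g (past u 0) x ->
  exists2 s, solution g u s & s 0 = x.
Proof.
move=> /encoding_setP[y yu y0].
pose fwd := fix fwd m := if m is m'.+1 then g (u m'%:Z, fwd m') else x.
exists (fun n : int => match n with Posz m => fwd m | Negz m => y m.+1 end) => //.
case=> [m|[|m]].
- by rewrite -PoszD addn1.
- by rewrite /= -y0 yu.
- have -> : Negz m.+1 + 1 = Negz m by lia.
  by rewrite yu /past; congr (g (u _, _)); lia.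
Qed.

Lemma unique_solution_encoding u :
  unique_solution g u -> is_subset1 (encoding_set g (past u 0)).
Proof.
move=> [s [_ suniq]] _ _ /encoding_solution[x xu <-] /encoding_solution[y yu <-].
by rewrite -(suniq x xu) -(suniq y yu).
Qed.

(** Every value of a solution lies in the encoding set of the past at that
time, so singletons determine the whole solution. *)
Lemma encoding_unique_solution u :
  (forall n, is_subset1 (encoding_set g (past u n))) -> unique_solution g u.
Proof.
move=> sub1.
have [x /encoding_solution[s su _]] := encoding_set_nonempty g (past u 0).
exists s; split=> // t tu; apply/funext => n.
by apply: (sub1 n); exact: solution_encoding.
Qed.

Lemma USP_encodingP :
  USP g <-> forall v : nat -> U, is_subset1 (encoding_set g v).
Proof.
split=> [usp v|sub1 u]; last by apply: encoding_unique_solution.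
(* U may be empty; [v 0] supplies the entries at nonnegative times. *)
pose u (n : int) := if n is Negz m then v m else v 0%N.
suff <- : past u 0 = v by apply: unique_solution_encoding.
by apply/funext => k; rewrite /past sub0r -NegzE.
Qed.

End encoding_orbits.

(** * Continuity of the encoding map *)

Section encoding_continuity.
Context {R : realType} {U X : metricType R} (g : driven_system U X).

Lemma past_map_joint_continuous n :
  continuous (fun p : {ptws nat -> U} * X => past_map g p.1 n p.2).
Proof.
elim: n => [|n IHn] p /=; first exact: cvg_snd.
pose step (q : {ptws nat -> U} * X) : {ptws nat -> U} * X :=
  (q.1, g (q.1 n, q.2)).
apply: (@continuous_comp _ _ _ step
  (fun q : {ptws nat -> U} * X => past_map g q.1 n q.2)); last exact: IHn.
apply: (@cvg_pair _ _ _ (nbhs p) (nbhs p.1) (nbhs (g (p.1 n, p.2)))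
  _ _ _ (fun q => q.1) (fun q => g (q.1 n, q.2))); first exact: cvg_fst.
apply: (@continuous_comp _ _ _
  (fun q : {ptws nat -> U} * X => (q.1 n, q.2)) g); last exact: driving_continuous.
apply: cvg_pair; last exact: cvg_snd.
apply: (@continuous_comp _ _ _ fst (fun v : {ptws nat -> U} => v n)).
  exact: cvg_fst.
exact: (@proj_continuous nat (fun=> U) n).
Qed.

(** Upper semicontinuity holds for every system: the inclusion of the encoding
set in V is witnessed by one finite composition, which depends on finitely many
entries of the input, uniformly over the compact state space. *)
Lemma encoding_upper_semicontinuous (v : {ptws nat -> U}) (V : set X) :
  open V -> encoding_set g v `<=` V -> \near v, encoding_set g v `<=` V.
Proof.
(* The index n.+1 skips the empty composition, which the encoding set omits. *)
move=> oV vV; have [|||n nV] := @decreasing_closed_sub_open X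
  (fun n => past_map g v n.+1 @` setT) V (state_compact g) _ _ oV.
- by move=> n; exact: past_map_closed.
- by move=> m n mn; exact: past_map_decreasing.
- by move=> x vx; apply: vV => -[//|n] _; exact: vx.
have cV : \forall w \near v, [set: X] `<=` (fun x => V (past_map g w n.+1 x)).
  have /compact_near_coveringP cX := state_compact g.
  apply: (cX _ (nbhs v) (fun w x => V (past_map g w n.+1 x))) => x _.
  have /= := @past_map_joint_continuous n.+1 (v, x) V _.
  case=> [|[A B] /= [vA xB] ABV].
    by apply: open_nbhs_nbhs; split=> //; apply: nV; exists x.
  by exists (B, A) => // -[y w] /= [By Aw]; exact: (ABV (w, y)).
apply: (@filterS _ _ (nbhs_filter v) _ _ _ cV).
by move=> w wV x /(_ n.+1 isT)[y _ <-]; exact: wV.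
Qed.

(** At a singleton, upper semicontinuity is full continuity, because the
encoding sets of nearby inputs are nonempty. *)
Lemma encoding_continuous_at_set1 (v : {ptws nat -> U}) :
  is_subset1 (encoding_set g v) -> {for v, continuous (encoding g)}.
Proof.
move=> v1; have [p vp] := encoding_set_nonempty g v.
have vsub : encoding_set g v `<=` [set p] by move=> x vx; exact: v1.
apply/(@metricType_numDomainType.cvgrPdist_le _ _ _ _ (nbhs_filter v)) => e e0.
have vV : encoding_set g v `<=` (ball p e)°.
  by move=> x /vsub ->; exact: nbhsx_ballx.
have oV : open (ball p e)° by exact: open_interior.
have := encoding_upper_semicontinuous v _ oV vV.
apply: (@filterS _ _ (nbhs_filter v)) => w wV.
apply: (@hausdorff_dist_set1_le R X p); [exact: encoding_set_nonempty|exact: vsub| |].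
  exact: encoding_set_nonempty.
exact: subset_trans wV (@interior_subset _ _).
Qed.

(** Any two points of the limit set are close to the single point of an
approximating encoding set, hence to each other. *)
Lemma encoding_set1_limit (v : {ptws nat -> U}) (w : nat -> {ptws nat -> U}) :
  {for v, continuous (encoding g)} -> w @ \oo --> v ->
  (forall n, is_subset1 (encoding_set g (w n))) -> is_subset1 (encoding_set g v).
Proof.
move=> cv wv w1 x y vx vy; apply: mdist_positivity; apply/eqP.
rewrite eq_le mdist_ge0 andbT; apply/ler_addgt0Pl => e e0; rewrite addr0.
have e20 : 0 < e / 2 by rewrite divr_gt0.
have /metricType_numDomainType.cvgr_dist_lt/(_ _ e20) :
  (encoding g \o w) @ \oo --> encoding g v by exact: cvg_comp wv cv.
move=> [n _ /(_ n (leqnn n)) /= wn].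
have [z wz] := encoding_set_nonempty g (w n).
have dz t : encoding_set g v t -> mdist t z <= e / 2.
  move=> vt; apply: le_trans (ltW wn).
  have := @dist_to_set_le_hausdorff R X (state_compact g)
    (encoding_set g v) (encoding_set g (w n)) t (encoding_set_nonempty g _) vt.
  apply: le_trans; apply: le_dist_to_set; first by exists z.
  by move=> b wb; rewrite (w1 n b z).
rewrite (splitr e); apply: le_trans (metric_triangle x z y) _.
by rewrite lerD ?dz// metric_sym dz.
Qed.

(** The past [p] followed in time by the [n] most recent entries of [v]. *)
Definition splice (v p : nat -> U) (n : nat) : nat -> U :=
  fun k => if (k < n)%N then v k else p (k - n)%N.

Lemma splice_cvg (v p : nat -> U) :
  (splice v p : nat -> {ptws nat -> U}) @ \oo --> (v : {ptws nat -> U}).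
Proof.
apply/pointwise_cvgP => k; apply: cvg_near_cst.
by exists k.+1 => // n /= kn; rewrite /splice kn.
Qed.

(** A backward orbit of the spliced past reaches the encoding set of [p] at time
[-n], and its later states are determined by that point. *)
Lemma splice_set1 (v p : nat -> U) n :
  is_subset1 (encoding_set g p) -> is_subset1 (encoding_set g (splice v p n)).
Proof.
move=> p1.
have tail y : backward_orbit g (splice v p n) y -> encoding_set g p (y n).
  move=> yu; apply/encoding_setP.
  exists (fun k => y (n + k)%N); last by rewrite addn0.
  by move=> k; rewrite yu /splice ltnNge leq_addr/= addKn addnS.
move=> x x' /encoding_setP[y yu <-] /encoding_setP[y' yu' <-].
rewrite (backward_orbit_past_map g n yu) (backward_orbit_past_map g n yu').
by congr past_map; apply: p1; exact: tail.
Qed.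

End encoding_continuity.

Theorem proposition2 (R : realType) (U X : metricType R)
    (g : driven_system U X) :
  [/\ USP g -> GIRST g,
      GIRST g -> (exists u : int -> U, unique_solution g u) -> USP g
    & (exists u : int -> U, unique_solution g u) -> (GIRST g <-> USP g)].
Proof.
have UG : USP g -> GIRST g.
  by move=> /USP_encodingP g1 v; exact: encoding_continuous_at_set1.
have GU : GIRST g -> (exists u : int -> U, unique_solution g u) -> USP g.
  move=> gc [u /unique_solution_encoding u1].
  apply/USP_encodingP => v.
  apply: (@encoding_set1_limit R U X g v (splice v (past u 0))) => [||n].
  - exact: gc.
  - exact: splice_cvg.
  - exact: splice_set1.
by split=> // u1; split=> [gc|]; [exact: GU|exact: UG].
Qed.
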